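(* Consider the optimization problem $$\max\ \sum_{w\in N}\sum_{b\in B}P_w(b,C_{wb})\left(\sum_{i\in b}c_i-C_{wb}\right)z_{wb}$$ subject to $\sum_{w\in N}\sum_{b\in B:\,i\in b}z_{wb}\le 1$ for all $i\in M$, $\sum_{b\in B}z_{wb}\le 1$ for all $w\in N$, $z_{wb}\in\{0,1\}$ and $C_{wb}\ge 0$ for all $w\in N$, $b\in B$. There exists an optimal solution of this problem in which each (optimal) compensation value $C^*_{wb}$, for every bundle $b$ offered to driver $w$, is calculated as $$C^*_{wb}=\operatorname*{arg\,max}_{C\ge 0}\ P_w(b,C)\left(\sum_{i\in b}c_i-C\right).$$
   Context: An operator offers bundles of delivery tasks to occasional drivers. $M$ is the (finite) set of tasks, $N$ the (finite) set of occasional drivers, and $B$ the set of all possible bundles, i.e. ordered tuples $(i_1,\dots,i_\ell)$ of distinct tasks of $M$; ''$i\in b$'' means that task $i$ occurs in the tuple $b$. $c_i\ge 0$ is the cost of having task $i$ delivered by a third-party logistics company (3PL). $P_w(b,C)$ is the probability that driver $w$ accepts bundle $b$ when offered compensation $C\ge 0$. Separability is assumed: this probability depends only on the driver, the bundle and the compensation, and neither the decision whether a bundle can be offered to a driver nor the compensation offered for it depends on the bundles offered to other drivers or on their compensations. The binary variable $z_{wb}$ indicates whether bundle $b$ is offered to driver $w$, and $C_{wb}$ is the compensation offered to $w$ for $b$.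
   Formalization: It is assumed that for every driver w and bundle b the maximum of P_w(b,C)(sum of c_i − C) over C ≥ 0 is attained; otherwise (e.g. P = 1 for C > 1 and 0 else, with cost 2) no optimal solution need exist. *)

(* Defs.v *)
From HB Require Import structures.
From mathcomp Require Import all_boot all_order all_algebra.
From mathcomp Require Import reals.

Set Implicit Arguments.
Unset Strict Implicit.
Unset Printing Implicit Defensive.

Import Order.TTheory GRing.Theory Num.Theory.
Local Open Scope ring_scope.

(* A duplicate-free sequence over M has length at most #|M|, so bounding the
   length loses no bundle and makes the type finite. *)
Definition bundle (M : finType) : finType :=
  {b : {bseq #|M| of M} | (0 < size b)%N && uniq b}.

Definition tasks (M : finType) (b : bundle M) : seq M := val b.

Lemma bundle_complete (M : finType) (s : seq M) :
  (0 < size s)%N -> uniq s -> exists b : bundle M, tasks b = s.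
Proof.
move=> s_gt0 s_uniq; have le_s : (size s <= #|M|)%N.
  by rewrite -(card_uniqP s_uniq) max_card.
have ok : (0 < size (Bseq le_s))%N && uniq (Bseq le_s) by rewrite s_gt0 s_uniq.
by exists (exist _ (Bseq le_s) ok).
Qed.

Definition is_argmax (R : realType) (T : Type) (A : T -> Prop) (f : T -> R)
  (x : T) : Prop := A x /\ forall y, A y -> f y <= f x.

Section BundleOffers.
Variables (R : realType) (M N : finType).
Variables (c : M -> R) (P : N -> bundle M -> R -> R).

Definition expected_saving (w : N) (b : bundle M) (C : R) : R :=
  P w b C * (\sum_(i in tasks b) c i - C).

Definition offers : Type :=
  ((N -> bundle M -> bool) * (N -> bundle M -> R))%type.

Definition feasible (x : offers) : Prop :=
  let: (z, C) := x in
  [/\ forall i : M,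
        (\sum_(w : N) \sum_(b : bundle M | i \in tasks b) (z w b : nat) <= 1)%N,
      forall w : N, (\sum_(b : bundle M) (z w b : nat) <= 1)%N
    & forall (w : N) (b : bundle M), 0 <= C w b].

Definition objective (x : offers) : R :=
  let: (z, C) := x in
  \sum_(w : N) \sum_(b : bundle M) expected_saving w b (C w b) * (z w b)%:R.

Definition optimal (x : offers) : Prop := is_argmax feasible objective x.

End BundleOffers.

(* Main.v *)
(* By separability, fixing an optimal compensation for every pair (w, b)
   dominates any other choice of compensations term by term, whatever z is;
   what remains is the maximisation over the finitely many binary z. *)
Require Import Defs.
From HB Require Import structures.
From mathcomp Require Import all_boot all_order all_algebra.
From mathcomp Require Import reals.

Set Implicit Arguments.
Unset Strict Implicit.
Unset Printing Implicit Defensive.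

Import Order.TTheory GRing.Theory Num.Theory.
Local Open Scope ring_scope.

Theorem proposition1 (R : realType) (M N : finType) (c : M -> R)
    (P : N -> bundle M -> R -> R)
    (c_ge0 : forall i : M, 0 <= c i)
    (P_prob : forall (w : N) (b : bundle M) (C : R), 0 <= C -> 0 <= P w b C <= 1)
    (argmax_exists : forall (w : N) (b : bundle M),
      exists C : R, is_argmax (fun C' : R => 0 <= C')
                      (fun C' : R => P w b C' * (\sum_(i in tasks b) c i - C')) C) :
  exists (z : N -> bundle M -> bool) (C : N -> bundle M -> R),
    optimal c P (z, C) /\
    forall (w : N) (b : bundle M), z w b ->
      is_argmax (fun C' : R => 0 <= C')
        (fun C' : R => P w b C' * (\sum_(i in tasks b) c i - C')) (C w b).
Proof.
(* Finiteness of [N] and of [bundle M] gathers the pointwise maximisers into a single function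
   [C]. *)
have /fin_all_exists [C C_max] (w : N) := fin_all_exists (argmax_exists w).
(* Finite functions on pairs form a [finType], so a best [u] can be picked by [arg_maxP]. *)
pose offer (u : {ffun N * bundle M -> bool}) w b := u (w, b).
pose valid u :=
  [forall i : M,
     \sum_(w : N) \sum_(b : bundle M | i \in tasks b) (offer u w b : nat) <= 1]%N
  && [forall w : N, \sum_(b : bundle M) (offer u w b : nat) <= 1]%N.
(* Offering nothing is valid, so the maximum is over a nonempty set. *)
have valid0 : valid [ffun=> false].
  apply/andP; split; apply/forallP => j.
    by rewrite big1 // => w _; rewrite big1 // => b _; rewrite /offer ffunE.
  by rewrite big1 // => b _; rewrite /offer ffunE.
have [u /andP[/forallP u_task /forallP u_driver] u_max] :=
  arg_maxP (fun u => objective c P (offer u, C)) valid0.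
exists (offer u), C; split=> [|w b _]; last exact: C_max.
split=> [|[z D] [z_task z_driver D_ge0]].
  by split=> // w b; case: (C_max w b).
(* The competitor's [z], recoded so that [u_max] applies to it. *)
pose v := [ffun p : N * bundle M => z p.1 p.2].
have offer_v w b : offer v w b = z w b by rewrite /offer ffunE.
have valid_v : valid v.
  apply/andP; split; apply/forallP => j.
    by under eq_bigr do under eq_bigr do rewrite offer_v.
  by under eq_bigr do rewrite offer_v.
(* The intermediate value keeps the competitor's [z] but replaces its compensations [D] by [C]. *)
apply: le_trans (u_max v valid_v).
apply: ler_sum => w _; apply: ler_sum => b _; rewrite offer_v.
by apply: ler_wpM2r => //; case: (C_max w b) => _; apply.
Qed.
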